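(* Let $T$ be a tree with $n\ge 4$ vertices, with $L$ leaves and $S$ support vertices. Then the following hold. (i) $\gamma^{LD}(T)\ge \dfrac{n+1+2(L-S)}{3}$. (ii) If every support vertex of $T$ is adjacent to only one leaf, then $\gamma^{ID}(T)\ge \dfrac{n+3}{3}$. (iii) If $T$ has an open locating dominating set, then $\gamma^{OLD}(T)\ge \dfrac{n+1}{2}$.
   Context: A leaf of a tree is a vertex of degree one; a support vertex is a vertex adjacent to at least one leaf. For a graph $G$ on vertex set $V$ and $x\in V$, $N(x)$ is the set of vertices adjacent to $x$ and $N[x]=N(x)\cup\{x\}$. A set $D\subseteq V$ is dominating if $N[x]\cap D\neq\emptyset$ for all $x\in V$, and total dominating if $N(x)\cap D\ne\emptyset$ for all $x\in V$. $\gamma^{LD}(G)$ is the minimum size of a locating dominating set, i.e. a dominating set $D$ with $N(x)\cap D\neq N(y)\cap D$ for all distinct $x,y\in V\setminus D$. $\gamma^{ID}(G)$ is the minimum size of an identifying code, i.e. a dominating set $D$ with $N[x]\cap D\neq N[y]\cap D$ for all distinct $x,y\in V$. $\gamma^{OLD}(G)$ is the minimum size of an open locating dominating set, i.e. a total dominating set $D$ with $N(x)\cap D\ne N(y)\cap D$ for all distinct $x,y\in V$. *)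

(* Defs.v *)
From mathcomp Require Import all_boot all_order all_algebra.
Set Implicit Arguments.
Unset Strict Implicit.
Unset Printing Implicit Defensive.

(* A finite simple graph is a symmetric irreflexive adjacency relation e on a
   finite type V of vertices. *)

Section Graphs.
Variables (V : finType) (e : rel V).

Definition simple_graph : Prop := symmetric e /\ irreflexive e.

Definition connected_graph : Prop := forall x y : V, connect e x y.

(* The bound 2 < size c excludes x :: y :: nil, which is a ucycle whenever x and
   y are adjacent but is not a cycle of the graph. *)
Definition acyclic_graph : Prop :=
  forall c : seq V, 2 < size c -> ~ ucycle e c.

Definition is_tree : Prop :=
  [/\ simple_graph, connected_graph & acyclic_graph].

Definition nbhd (x : V) : {set V} := [set y | e x y].
Definition cnbhd (x : V) : {set V} := x |: nbhd x.

Definition leaves : {set V} := [set x | #|nbhd x| == 1].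
Definition supports : {set V} := [set x | [exists y in leaves, e x y]].

Definition dominating (D : {set V}) : bool :=
  [forall x, cnbhd x :&: D != set0].
Definition total_dominating (D : {set V}) : bool :=
  [forall x, nbhd x :&: D != set0].

Definition locating_dominating (D : {set V}) : bool :=
  dominating D &&
  [forall x in ~: D, forall y in ~: D,
     (x != y) ==> (nbhd x :&: D != nbhd y :&: D)].

Definition identifying_code (D : {set V}) : bool :=
  dominating D &&
  [forall x, forall y, (x != y) ==> (cnbhd x :&: D != cnbhd y :&: D)].

Definition open_locating_dominating (D : {set V}) : bool :=
  total_dominating D &&
  [forall x, forall y, (x != y) ==> (nbhd x :&: D != nbhd y :&: D)].

(* The minimum size of a set satisfying P. The value is 0 when there is no such
   set, so that a positive lower bound on min_card P is never vacuous: it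
   entails that some set satisfies P. *)
Definition min_card (P : pred {set V}) : nat :=
  if [pick D | P D] is Some D0 then #|[arg min_(D < D0 | P D) #|D|]| else 0.

Lemma min_cardP (P : pred {set V}) : (exists D, P D) ->
  (exists2 D, P D & #|D| = min_card P) /\ (forall D, P D -> min_card P <= #|D|).
Proof.
rewrite /min_card => -[D PD]; case: pickP => [D0 PD0|/(_ D)]; last by rewrite PD.
by case: arg_minnP => // D1 PD1 minD1; split=> //; exists D1.
Qed.

Definition gammaLD : nat := min_card locating_dominating.
Definition gammaID : nat := min_card identifying_code.
Definition gammaOLD : nat := min_card open_locating_dominating.

End Graphs.

(* Main.v *)
(* Let D be a code, d = |D|. The codes of the vertices are distinct subsets of D,
   so at most d of them are singletons and the others have size at least two:
   2 n <= d + (sum of the code sizes). On the other hand the sum of the code sizes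
   counts the edges with an end in D, twice if both ends are in D (plus d in the
   case of closed neighbourhoods), and m > 0 vertices of a forest span at most
   m - 1 edges; comparing both estimates bounds n.
   For open locating dominating sets this is all. For identifying codes one unit
   is gained because either some code has size at least three or D is independent.
   For locating dominating sets the leaves contained in D are first deleted: at
   most one leaf per support vertex lies outside D, and the only codes altered by
   the deletion belong to support vertices all of whose leaves are in D. *)
Require Import Defs.
From mathcomp Require Import all_boot all_order all_algebra.
From mathcomp Require Import zify lra.
Import GRing.Theory Num.Theory.

(** * Sizes of distinct codes *)

Section Codes.
Context {T U : finType}.
Implicit Types (X : {set T}) (D : {set U}) (f : T -> {set U}).

Lemma inj_codes_bound X D f :
    {in X &, injective f} ->
    (forall x, x \in X -> f x != set0) ->
    (forall x, x \in X -> f x \subset D) ->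
  2 * #|X| <= #|D| + \sum_(x in X) #|f x|.
Proof.
move=> f_inj f_n0 f_sub.
pose X1 := [set x in X | #|f x| == 1].
have X1_le : #|X1| <= #|D|.
  have f_inj1 : {in X1 &, injective f}.
    by move=> x y; rewrite !inE => /andP[xX _] /andP[yX _]; exact: f_inj.
  rewrite -(card_in_imset f_inj1).
  rewrite -(card_imset D set1_inj); apply/subset_leq_card/subsetP => A /imsetP[x].
  rewrite inE => /andP[xX /cards1P[v fxv]] ->; rewrite fxv imset_f //.
  by rewrite -sub1set -fxv f_sub.
(* A nonempty code of size k satisfies 2 <= k + [k = 1]; this is summed over [X]. *)
apply: leq_trans (leq_add X1_le (leqnn _)).
rewrite mulnC -sum_nat_const -sum1_card.
rewrite [X in _ <= X + _](_ : _ = \sum_(x in X) (#|f x| == 1)).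
  rewrite -big_split leq_sum // => x xX.
  by have := f_n0 x xX; rewrite -card_gt0; case: #|f x| => [|[|k]].
rewrite [RHS]big_mkcond [LHS]big_mkcond; apply: eq_bigr => x _; rewrite inE.
by case: (x \in X); case: (#|f x| == 1).
Qed.

(** Removing [x0] lowers the left side of the previous bound by 2 and its right side by at least
    3. *)
Lemma inj_codes_bound_ge3 X D f x0 :
    {in X &, injective f} ->
    (forall x, x \in X -> f x != set0) ->
    (forall x, x \in X -> f x \subset D) ->
    x0 \in X -> 2 < #|f x0| ->
  2 * #|X| + 1 <= #|D| + \sum_(x in X) #|f x|.
Proof.
move=> f_inj f_n0 f_sub x0X fx0.
have sub y : y \in X :\ x0 -> y \in X by rewrite in_setD1 => /andP[].
have f_inj' : {in X :\ x0 &, injective f}.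
  by move=> x y /sub xX /sub yX; exact: f_inj.
have := inj_codes_bound _ _ _ f_inj' (fun x xX => f_n0 x (sub x xX))
  (fun x xX => f_sub x (sub x xX)).
rewrite (cardsD1 x0 X) x0X (big_setD1 x0 x0X) /=; lia.
Qed.

End Codes.

(** * Edge counts in forests *)

Section Forests.
Context {V : finType} (e : rel V).
Implicit Types A B D : {set V}.

(** Ordered pairs are counted: in a simple graph an edge inside [A] contributes 2 to [arcs A A], an
    edge between disjoint [A] and [B] contributes 1 to [arcs A B]. *)
Definition arcs A B := \sum_(x in A) #|nbhd e x :&: B|.

Lemma arcsE A B : arcs A B = \sum_(x in A) \sum_(y in B) e x y.
Proof.
apply: eq_bigr => x _; rewrite -sum1_card big_mkcond [RHS]big_mkcond.
by apply: eq_bigr => y _; rewrite !inE; case: (e x y); case: (y \in B).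
Qed.

Lemma arcsC A B : symmetric e -> arcs A B = arcs B A.
Proof.
move=> e_sym; rewrite !arcsE exchange_big.
by apply: eq_bigr => x _; apply: eq_bigr => y _; rewrite e_sym.
Qed.

Lemma arcsUl A B D :
  [disjoint A & B] -> arcs (A :|: B) D = arcs A D + arcs B D.
Proof. by move=> AB; rewrite /arcs -bigU //; apply: eq_bigl => x; rewrite inE. Qed.

Lemma arcsUU A B : symmetric e -> [disjoint A & B] ->
  arcs (A :|: B) (A :|: B) = arcs A A + 2 * arcs A B + arcs B B.
Proof.
move=> e_sym AB; rewrite arcsUl // (arcsC A) // (arcsC B) // !arcsUl //.
by rewrite (arcsC B A) //; lia.
Qed.

Lemma arcs1 x B : arcs [set x] B = #|nbhd e x :&: B|.
Proof. exact: big_set1. Qed.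

(** Otherwise a path in [A] could be prolonged forever without turning back; acyclicity keeps its
    vertices distinct, so it would outgrow [V]. *)
Lemma acyclic_low_degree A : symmetric e -> irreflexive e -> acyclic_graph e ->
  A != set0 -> exists2 x, x \in A & #|nbhd e x :&: A| <= 1.
Proof.
move=> e_sym e_irr acyc /set0Pn[x0 x0A].
case: (pickP [pred x in A | #|nbhd e x :&: A| <= 1]) => [x /andP[]|high].
  by exists x.
have next x y : x \in A -> exists z, [/\ z \in A, e x z & z != y].
  move=> xA; have := high x; rewrite /= xA /= => /negbT; rewrite -ltnNge => deg.
  have : 0 < #|(nbhd e x :&: A) :\ y|.
    by have := cardsD1 y (nbhd e x :&: A); case: (y \in _) => /=; lia.
  by case/card_gt0P => z /[!inE] /and3P[zy exz zA]; exists z.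
have long k : exists x s, [/\ path e x s, uniq (x :: s), x \in A & size s = k].
  elim: k => [|k [x [s [xs_path xs_uniq xA <-]]]]; first by exists x0, nil.
  (* The path grows at its front, avoiding the vertex it came from; for empty [s] the default [x]
     only asks that [z] differ from [x]. *)
  have [z [zA exz z_head]] := next x (head x s) xA.
  have zx : z != x by apply: contraTneq exz => ->; rewrite e_irr.
  have [zs|zs] := boolP (z \in s); last first.
    exists z, (x :: s); split=> //=; first by rewrite e_sym exz.
    by rewrite inE negb_or zx zs.
  case/splitPr: zs xs_path xs_uniq z_head => s1 s2.
  rewrite cat_path -cat_cons cat_uniq => /andP[path1 /= /andP[elz _]].
  move=> /and3P[/= /andP[xs1 uniq1] nos2 _] z_head; exfalso.
  (* Since [z] is not the head of the old tail, [s1] is nonempty and the cycle has at least three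
     vertices. *)
  apply: (acyc (x :: rcons s1 z)).
    by case: (s1) z_head => [|y t] /=; rewrite ?eqxx // size_rcons.
  rewrite /ucycle /= rcons_path last_rcons e_sym exz andbT rcons_path path1 elz.
  rewrite mem_rcons inE eq_sym negb_or zx xs1 rcons_uniq uniq1 andbT.
  by move: nos2; rewrite negb_or inE negb_or => /andP[/andP[_ ->]].
have [x [s [_ xs_uniq _ sz]]] := long #|V|.
by have := max_card (mem (x :: s)); rewrite (card_uniqP xs_uniq) /= sz ltnn.
Qed.

(** Induction on the size of [A]: deleting a vertex with at most one neighbour in [A] lowers
    [arcs A A] by at most 2. *)
Lemma acyclic_arcs_bound A : symmetric e -> irreflexive e -> acyclic_graph e ->
  A != set0 -> arcs A A + 2 <= 2 * #|A|.
Proof.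
move=> e_sym e_irr acyc.
have [k] := ubnP #|A|; elim: k A => // k IHk A ltAk A_n0.
have [x xA degx] := acyclic_low_degree A e_sym e_irr acyc A_n0.
have arcs_x : arcs [set x] [set x] = 0.
  rewrite arcs1; apply/eqP; rewrite cards_eq0 -subset0; apply/subsetP => y.
  by rewrite !inE andbC => /andP[/eqP->]; rewrite e_irr.
have disj : [disjoint [set x] & A :\ x] by rewrite disjoints1 setD11.
have := arcsUU _ _ e_sym disj; rewrite setD1K // arcs_x => ->.
have deg' : arcs [set x] (A :\ x) <= 1.
  rewrite arcs1; apply: leq_trans degx; apply/subset_leq_card/setIS.
  exact: subsetDl.
have cardA := cardsD1 x A; rewrite xA in cardA.
have [A'0|A'_n0] := eqVneq (A :\ x) set0.
  by rewrite A'0 [arcs set0 set0]big_set0 arcs1 setI0 cards0; lia.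
by have := IHk (A :\ x) _ A'_n0; lia.
Qed.

Lemma acyclic_cut_bound A B : symmetric e -> irreflexive e -> acyclic_graph e ->
  [disjoint A & B] -> A :|: B != set0 -> arcs A B + 1 <= #|A| + #|B|.
Proof.
move=> e_sym e_irr acyc AB n0.
have := acyclic_arcs_bound _ e_sym e_irr acyc n0; rewrite arcsUU // cardsU.
by rewrite disjoint_setI0 // cards0; lia.
Qed.

(** The forest bound for all of [V] is split along [D] and its complement, and the arcs inside the
    complement are discarded. *)
Lemma acyclic_total_bound D : symmetric e -> irreflexive e -> acyclic_graph e ->
  D != set0 -> 2 * arcs [set: V] D + 2 <= 2 * #|V| + arcs D D.
Proof.
move=> e_sym e_irr acyc D_n0.
have disj : [disjoint D & ~: D] by rewrite -setI_eq0 setICr.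
have V_n0 : [set: V] != set0.
  by apply: contraNneq D_n0 => V0; rewrite -subset0 -V0 subsetT.
have := acyclic_arcs_bound _ e_sym e_irr acyc V_n0.
rewrite cardsT -(setUCr D) arcsUU // arcsUl // (arcsC (~: D) D) //; lia.
Qed.

(** * Connectedness, leaves and twins *)

Lemma connected_pair x y : symmetric e -> connected_graph e ->
  nbhd e x \subset [set y] -> nbhd e y \subset [set x] -> #|V| <= 2.
Proof.
move=> e_sym conn /subsetP Nx /subsetP Ny.
have step u v : e u v -> u \in [set x; y] -> v \in [set x; y].
  move=> euv; rewrite !inE => /orP[]/eqP uE; subst u.
    by have := Nx v; rewrite !inE => -> //; rewrite orbT.
  by have := Ny v; rewrite !inE => ->.
have clos : closed e (mem [set x; y]).
  by move=> u v euv; apply/idP/idP; apply: step; rewrite // e_sym.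
have : [set: V] \subset [set x; y].
  apply/subsetP => z _; rewrite -(closed_connect clos (conn x z)).
  by rewrite !inE eqxx.
move/subset_leq_card; rewrite cardsT => /leq_trans->//.
by rewrite cards2; case: (x != y).
Qed.

Lemma leaf_nbhdP x : x \in leaves e -> exists y, nbhd e x = [set y].
Proof. by rewrite inE => /cards1P. Qed.

Lemma tree_nonleaf : is_tree e -> 2 < #|V| -> ~: leaves e != set0.
Proof.
move=> [[e_sym _] conn _] cardV; apply: contraL cardV; rewrite -leqNgt => /eqP all.
have leafT z : z \in leaves e by apply: contraT; rewrite -in_setC all inE.
have [->//|/card_gt0P[x _]] := posnP #|V|.
have [y Nx] := leaf_nbhdP x (leafT x); have [z Ny] := leaf_nbhdP y (leafT y).
apply: (connected_pair x y) => //; first by rewrite Nx.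
have : x \in nbhd e y by rewrite inE e_sym -[e x y]in_set -/(nbhd e x) Nx set11.
by rewrite Ny inE => /eqP->.
Qed.

(** Distinct vertices with equal closed neighbourhoods are adjacent, and a third neighbour would
    close a triangle; so they would be the whole tree. *)
Lemma tree_identifying_codeT : is_tree e -> 2 < #|V| -> identifying_code e setT.
Proof.
move=> [[e_sym e_irr] conn acyc] cardV; apply/andP; split.
  apply/forallP => x; rewrite setIT; apply/set0Pn; exists x.
  by rewrite !inE eqxx.
apply/forallP => x; apply/forallP => y; apply/implyP => xy; rewrite !setIT.
apply: contraL cardV => /eqP eqN; rewrite -leqNgt.
have memN z : (z == x) || e x z = (z == y) || e y z.
  by have /setP/(_ z) := eqN; rewrite !inE.
have exy : e x y by have := memN y; rewrite eqxx eq_sym (negPf xy).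
have eyx : e y x by rewrite e_sym.
apply: (connected_pair x y) => //; apply/subsetP => z; rewrite !inE => ez.
  apply: contraT => zy; have := memN z; rewrite (negPf zy) ez orbT /= => eyz.
  case: (acyc [:: y; x; z]) => //; rewrite /ucycle /= eyx ez (e_sym z) -eyz /=.
  rewrite !inE !negb_or (eq_sym y) xy eq_sym zy /=.
  by rewrite andbT; apply: contraTneq ez => ->; rewrite e_irr.
apply: contraT => zx; have := memN z; rewrite (negPf zx) ez orbT /= => exz.
case: (acyc [:: x; y; z]) => //; rewrite /ucycle /= exy ez (e_sym z) exz /=.
rewrite !inE !negb_or xy eq_sym zx /=.
by rewrite andbT; apply: contraTneq ez => ->; rewrite e_irr.
Qed.

(** * Bounds for the three kinds of codes *)

Lemma locating_dominating_bound D : is_tree e -> 2 < #|V| ->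
  locating_dominating e D ->
  #|V| + 1 + 2 * #|leaves e| <= 3 * #|D| + 2 * #|supports e|.
Proof.
move=> treeV cardV /andP[/forallP domD /'forall_in_forall_inP locD].
have [[e_sym e_irr] conn acyc] := treeV.
have sepD x y : x \notin D -> y \notin D ->
    nbhd e x :&: D = nbhd e y :&: D -> x = y.
  move=> xD yD eqN; apply: contraTeq isT => xy.
  by have := locD x _ y; rewrite !inE => /(_ xD yD)/implyP/(_ xy); rewrite eqN eqxx.
pose inner := D :\: leaves e.
(* S1 lies in D and has at least as many elements as there are leaves outside D;
   a vertex outside D with a neighbour among the leaves in D is a support vertex
   not in S1. *)
pose S1 := [set s in supports e | [exists l in leaves e :\: D, e s l]].
have S1sub : S1 \subset supports e by apply/subsetP => s; rewrite inE => /andP[].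
(* A leaf outside [D] can be dominated only by its unique neighbour. *)
have S1D : S1 \subset D.
  apply/subsetP => s; rewrite inE => /andP[_ /'exists_andP[l [/setDP[lL lD] esl]]].
  have [t Nl] := leaf_nbhdP l lL.
  have : s \in nbhd e l by rewrite inE e_sym.
  rewrite Nl inE => /eqP ->.
  have /set0Pn[u] := domD l; rewrite /cnbhd Nl !inE.
  by case/andP => /orP[]/eqP->// lD'; rewrite lD' in lD.
have out_le : #|leaves e :\: D| <= #|S1|.
  pose f l := odflt l [pick s in nbhd e l].
  have fP l : l \in leaves e -> nbhd e l = [set f l].
    case/leaf_nbhdP => s Nl; rewrite /f; case: pickP => [t|/(_ s)].
      by rewrite Nl inE => /eqP->.
    by rewrite Nl set11.
  have f_inj : {in leaves e :\: D &, injective f}.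
    move=> x y /setDP[xL xD] /setDP[yL yD] fxy.
    by apply: sepD => //; rewrite !fP // fxy.
  rewrite -(card_in_imset f_inj).
  apply/subset_leq_card/subsetP => _ /imsetP[l lLD ->].
  have /setDP[lL lD] := lLD.
  have : f l \in nbhd e l by rewrite fP ?set11.
  rewrite inE => elf; rewrite !inE; apply/andP; split.
    by apply/'exists_andP; exists l; split=> //; rewrite e_sym.
  by apply/'exists_andP; exists l; split=> //; rewrite e_sym.
pose X := ~: D :\: (supports e :\: S1).
have X_sub : X \subset ~: D by apply: subsetDl.
have codeX x : x \in X -> nbhd e x :&: inner = nbhd e x :&: D.
  move=> /setDP[xD]; rewrite in_setC in xD => xS; apply/setP => y.
  rewrite [LHS]in_setI [RHS]in_setI [y \in inner]in_setD.
  have [yL|//] := boolP (y \in leaves e).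
  have [|//] := boolP (y \in nbhd e x); rewrite inE => exy.
  case: (boolP (y \in D)) => // yD; case/negP: xS.
  rewrite in_setD (contra (subsetP S1D x) xD) inE.
  by apply/'exists_andP; exists y.
have X_out : #|~: D| <= #|X| + (#|supports e| - #|S1|).
  have := cardsID (supports e :\: S1) (~: D).
  have := subset_leq_card (subsetIr (~: D) (supports e :\: S1)).
  have := cardsD (supports e) S1; rewrite (setIidPr S1sub) -/X; lia.
have codes : 2 * #|X| <= #|inner| + arcs X inner.
  apply: inj_codes_bound => [x y xX yX fxy|x xX|x _]; last exact: subsetIr.
    rewrite !codeX // in fxy.
    by apply: sepD => //; rewrite -in_setC (subsetP X_sub).
  rewrite codeX //; have /set0Pn[u] := domD x.
  have : x \notin D by rewrite -in_setC (subsetP X_sub).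
  move=> xD /setIP[/setU1P[->|uN] uD]; first by rewrite uD in xD.
  by apply/set0Pn; exists u; rewrite inE uN.
have arcsX : arcs X inner <= arcs (~: D) inner.
  by rewrite [leqRHS](big_setID X) /= (setIidPr X_sub) leq_addr.
have cut : arcs (~: D) inner + 1 <= #|~: D| + #|inner|.
  apply: acyclic_cut_bound => //.
    by rewrite disjoints_subset setCS subsetDl.
  have /set0Pn[u] := tree_nonleaf treeV cardV; rewrite inE => uL.
  by apply/set0Pn; exists u; rewrite !in_setU in_setD uL in_setC; case: (u \in D).
(* As [inner] has |D| - |leaves| + |leaves outside D| elements, [out_le] makes the terms in [S1]
   cancel. *)
have := cardsID D (leaves e); have := cardsID (leaves e) D; rewrite setIC -/inner.
have := subset_leq_card S1sub; have := cardsC D; lia.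
Qed.

Lemma identifying_code_bound D : is_tree e -> 1 < #|V| ->
  identifying_code e D -> #|V| + 3 <= 3 * #|D|.
Proof.
move=> [[e_sym e_irr] conn acyc] cardV /andP[/forallP domD /forallP idD].
have sepD : {in [set: V] &, injective (fun x => cnbhd e x :&: D)}.
  move=> x y _ _ eqN; apply: contraTeq isT => xy.
  by have /forallP/(_ y)/implyP/(_ xy) := idD x; rewrite eqN eqxx.
have subD x : x \in [set: V] -> cnbhd e x :&: D \subset D by move=> _; apply: subsetIr.
have D_n0 : D != set0.
  have /card_gt0P[x _] : 0 < #|V| by apply: ltnW.
  by apply: contraNneq (domD x) => ->; rewrite setI0.
have codes := inj_codes_bound _ _ _ sepD (fun x _ => domD x) subD.
have codes3 x := inj_codes_bound_ge3 _ _ _ x sepD (fun x _ => domD x) subD (in_setT x).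
have sumE : \sum_(x in [set: V]) #|cnbhd e x :&: D| = #|D| + arcs [set: V] D.
  transitivity (\sum_(x in [set: V]) ((x \in D) + #|nbhd e x :&: D|)).
    apply: eq_bigr => x _; rewrite /cnbhd setIUl cardsU.
    rewrite (_ : #|[set x] :&: D| = (x \in D)); last first.
      by have [xD|xD] := boolP (x \in D); [rewrite (setIidPl _) ?cards1 ?sub1set|
        rewrite disjoint_setI0 ?cards0 ?disjoints1].
    rewrite (_ : _ :&: (_ :&: _) = set0) ?cards0 ?subn0 //.
    by apply/setP => y; rewrite !inE; case: eqP => // ->; rewrite e_irr andbF.
  rewrite big_split /= -[#|D|]sum1_card [in RHS]big_mkcond /=; congr (_ + _).
  by apply: eq_big => x; rewrite ?inE //; case: (x \in D).
rewrite sumE cardsT in codes codes3.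
have total := acyclic_total_bound D e_sym e_irr acyc D_n0.
have inside := acyclic_arcs_bound D e_sym e_irr acyc D_n0.
(* With n = |V| and d = |D|, the bounds so far give n + 2 <= 3 d. A code of size at least three
   yields the missing unit; if [D] spans no edge, they give n <= 2 d - 1, and n > 1 then forces d >=
   2. *)
case: (pickP (fun x => 2 < #|cnbhd e x :&: D|)) => [x /codes3|small]; first lia.
(* Adjacent x, y in D with codes of size at most 2 would both have code {x, y}. *)
suff : arcs D D = 0 by lia.
apply: big1 => x xD; apply/eqP; rewrite cards_eq0 -subset0; apply/subsetP => y.
rewrite !inE => /andP[exy yD].
have xy : x != y by apply: contraTneq exy => ->; rewrite e_irr.
have pairE u v : u != v -> e u v -> u \in D -> v \in D -> cnbhd e u :&: D = [set u; v].
  move=> uv euv uD vD; apply/esym/eqP; rewrite eqEcard cards2 uv leqNgt small andbT.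
  by apply/subsetP => z; rewrite !inE => /orP[]/eqP->; rewrite ?eqxx ?euv ?orbT.
case/eqP: (xy); apply: sepD; rewrite ?inE // (pairE x y) // setUC (pairE y x) //.
  by rewrite eq_sym.
by rewrite e_sym.
Qed.

(** Twice the code estimate plus the two forest bounds gives 2 n + 4 <= 4 d, half a unit more for d
    than the theorem claims. *)
Lemma open_locating_dominating_bound D : symmetric e -> irreflexive e ->
  acyclic_graph e -> 0 < #|V| ->
  open_locating_dominating e D -> #|V| + 2 <= 2 * #|D|.
Proof.
move=> e_sym e_irr acyc cardV /andP[/forallP domD /forallP idD].
have sepD : {in [set: V] &, injective (fun x => nbhd e x :&: D)}.
  move=> x y _ _ eqN; apply: contraTeq isT => xy.
  by have /forallP/(_ y)/implyP/(_ xy) := idD x; rewrite eqN eqxx.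
have subD x : x \in [set: V] -> nbhd e x :&: D \subset D by move=> _; apply: subsetIr.
have D_n0 : D != set0.
  have /card_gt0P[x _] := cardV.
  by apply: contraNneq (domD x) => ->; rewrite setI0.
have := inj_codes_bound _ _ _ sepD (fun x _ => domD x) subD.
rewrite cardsT -/(arcs _ _).
have := acyclic_total_bound D e_sym e_irr acyc D_n0.
have := acyclic_arcs_bound D e_sym e_irr acyc D_n0; lia.
Qed.

End Forests.

(** * Passage to rational bounds *)

Local Open Scope ring_scope.

Theorem corollary4p1 (V : finType) (e : rel V) (n L S : nat)
    (treeV : is_tree e) (n_def : #|V| = n) (n_ge4 : (4 <= n)%N)
    (L_def : #|leaves e| = L) (S_def : #|supports e| = S) :
  [/\ (gammaLD e)%:R >= (n%:R + 1 + 2 * (L%:R - S%:R)) / 3 :> rat,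
      (forall s : V, s \in supports e -> #|nbhd e s :&: leaves e| = 1%N) ->
        (gammaID e)%:R >= (n%:R + 3) / 3 :> rat
    & (exists D : {set V}, open_locating_dominating e D) ->
        (gammaOLD e)%:R >= (n%:R + 1) / 2 :> rat].
Proof.
have cardV : (2 < #|V|)%N by rewrite n_def; lia.
have [[e_sym e_irr] _ acyc] := treeV.
(* The full vertex set shows that the first two minima are attained and are not the default value
   0. *)
have ID_T := tree_identifying_codeT e treeV cardV.
split=> [|_|exD].
- have LD_T : locating_dominating e setT.
    rewrite /locating_dominating (andP ID_T).1 setCT.
    by apply/forallP => x; rewrite inE.
  have [[D LD_D]]
    := min_cardP (ex_intro [eta locating_dominating e] _ LD_T).
  rewrite -/(gammaLD e) => <- _.
  have := locating_dominating_bound e D treeV cardV LD_D.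
  rewrite n_def L_def S_def -(ler_nat rat) !(natrM, natrD); lra.
- have [[D ID_D]]
    := min_cardP (ex_intro [eta identifying_code e] _ ID_T).
  rewrite -/(gammaID e) => <- _.
  have := identifying_code_bound e D treeV (ltnW cardV) ID_D.
  rewrite n_def -(ler_nat rat) !(natrM, natrD); lra.
- have [[D OLD_D]] := min_cardP exD; rewrite -/(gammaOLD e) => <- _.
  have := open_locating_dominating_bound e D e_sym e_irr acyc
    (ltnW (ltnW cardV)) OLD_D.
  rewrite n_def -(ler_nat rat) !(natrM, natrD); lra.
Qed.
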